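(* Let $q$ be a fixed natural number. For every natural number $n$, $$t_q(n)=\begin{cases}2^{n-1},&\text{if } n\le q,\\ \sum_{j=1}^{q}t_q(n-j),&\text{if } n>q.\end{cases}$$
   Context: Natural numbers are positive integers. A composition of a natural number $n$ is an ordered finite sequence $(a_1,\dots,a_k)$, $k\ge 1$, of natural numbers (called its parts) with $n=a_1+a_2+\cdots+a_k$; sequences differing in order are different compositions. For natural numbers $q$ and $n$, $t_q(n)$ denotes the number of compositions of $n$ all of whose parts are less than or equal to $q$. *)

(* Defs.v *)
From HB Require Import structures.
From mathcomp Require Import all_boot.

Set Implicit Arguments.
Unset Strict Implicit.
Unset Printing Implicit Defensive.

Definition is_composition (n : nat) (s : seq nat) : bool :=
  [&& 0 < size s, all (fun a => 0 < a) s & sumn s == n].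

Record composition (n : nat) : Type := Composition {
  parts :> seq nat;
  compositionP : is_composition n parts
}.

HB.instance Definition _ n := [isSub for @parts n].
HB.instance Definition _ n := [Countable of composition n by <:].

(* A composition of n has at most n parts, each at most n, so compositions of n
   embed into the bounded sequences n.-bseq 'I_n.+1; this gives finiteness. *)
Lemma composition_size n (c : composition n) : size c <= n.
Proof.
case: c => s /= /and3P[_ s_gt0 /eqP <-].
elim: s s_gt0 => //= a s IHs /andP[a_gt0 /IHs le_s].
by rewrite -add1n leq_add.
Qed.

Lemma composition_part_le n (c : composition n) a : a \in parts c -> a <= n.
Proof.
case: c => s /= /and3P[_ _ /eqP <-].
elim: s => //= b s IHs; rewrite inE => /predU1P[-> | /IHs le_a].
  exact: leq_addr.
exact: leq_trans le_a (leq_addl _ _).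
Qed.

Definition bseq_of_composition n (c : composition n) : n.-bseq 'I_n.+1 :=
  insub_bseq n [seq inord a | a <- c].

Definition composition_of_bseq n (b : n.-bseq 'I_n.+1) : option (composition n) :=
  insub [seq val i | i <- b].

Lemma bseq_of_compositionK n :
  pcancel (@bseq_of_composition n) (@composition_of_bseq n).
Proof.
move=> c; rewrite /composition_of_bseq /bseq_of_composition.
have sz : size [seq inord a : 'I_n.+1 | a <- c] <= n.
  by rewrite size_map composition_size.
rewrite /insub_bseq val_insubd sz -map_comp.
suff -> : [seq (val \o inord (n' := n)) a | a <- c] = parts c by exact: valK.
by apply: map_id_in => a a_c; rewrite /= inordK // ltnS (composition_part_le a_c).
Qed.

HB.instance Definition _ n : isFinite (composition n) :=
  PCanIsFinite (@bseq_of_compositionK n).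

Definition t (q n : nat) : nat :=
  #|[set c : composition n | all (fun a => a <= q) (parts c)]|.

(* Main.v *)
(** Splitting off the first part [j] of a composition of [n] leaves either
    nothing (when [j = n]) or a composition of [n - j].  Hence, for [n > 0],
    [t q n = (n <= q) + \sum_(1 <= j <= q) t q (n - j)], where the terms with
    [j >= n] vanish because [0] has no composition.  For [n > q] this is the
    claimed recurrence; for [n <= q] it yields [2 ^ (n - 1)] by induction. *)
Require Import Defs.
From mathcomp Require Import all_boot.

(** Plain sequences rather than elements of [composition n]: this way compositions of different
    numbers share one type, so prepending a part needs no transport. *)
Definition bounded_compositions (q n : nat) : seq (seq nat) :=
  [seq parts c | c in [set c : composition n | all (fun a => a <= q) (parts c)]].

Lemma size_bounded_compositions q n : size (bounded_compositions q n) = t q n.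
Proof. by rewrite size_image. Qed.

Lemma bounded_compositions_uniq q n : uniq (bounded_compositions q n).
Proof. by rewrite map_inj_uniq ?enum_uniq //; apply: val_inj. Qed.

Lemma mem_bounded_compositions q n s :
  (s \in bounded_compositions q n) =
  is_composition n s && all (fun a => a <= q) s.
Proof.
apply/imageP/andP => [[c + ->] | [s_comp s_le]].
  by rewrite inE => c_le; split=> //; apply: compositionP.
by exists (Composition s_comp) => //; rewrite inE.
Qed.

Lemma mem_bounded_compositions_cons q n j s : 0 < n ->
  (j :: s \in bounded_compositions q n) =
  (j \in iota 1 q) &&
  ((j == n) && (s == [::]) || (s \in bounded_compositions q (n - j))).
Proof.
move=> n_gt0; rewrite !mem_bounded_compositions /is_composition mem_iota add1n ltnS /=.
case: s => [|a s] /=.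
  by rewrite addn0 !andbT !orbF andbAC.
rewrite andbF /=.
case: (posnP a) => [->|a_gt0]; first by rewrite !andbF.
(* Subtraction is truncated; [0 < a] makes [n - j] positive, hence [j < n], and the equation can be
   moved across. *)
have -> : (a + sumn s == n - j) = (j + (a + sumn s) == n).
  apply/eqP/eqP => [e | <-]; last by rewrite addKn.
  rewrite e subnKC // ltnW // -subn_gt0 -e.
  by rewrite addn_gt0 a_gt0.
by case: (0 < j); case: (j <= q); rewrite ?andbF.
Qed.

(** Both sides are lengths of duplicate-free lists with the same members, hence permutations of each
    other. *)
Lemma t_first_part q n : 0 < n ->
  t q n = (n <= q) + \sum_(1 <= j < q.+1) t q (n - j).
Proof.
move=> n_gt0.
pose longer := [seq j :: s | j <- iota 1 q, s <- bounded_compositions q (n - j)].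
(* The boolean serves as a multiplicity 0 or 1: the one-part composition counts only if [n <= q]. *)
pose single := nseq (n <= q) [:: n].
have mem_longer j s : (j :: s \in longer) =
    (j \in iota 1 q) && (s \in bounded_compositions q (n - j)).
  apply/allpairsPdep/andP => [[i [r [i_q r_in [-> ->]]]] // | [j_q s_in]].
  by exists j, s.
have nil_longer : [::] \notin longer by apply/allpairsPdep => -[? [? []]].
have nil_notin m : [::] \notin bounded_compositions q m.
  by rewrite mem_bounded_compositions.
have mem_single s : (s \in single) = (n <= q) && (s == [:: n]).
  by rewrite mem_nseq lt0b.
have perm : perm_eq (bounded_compositions q n) (single ++ longer).
  apply: uniq_perm; first exact: bounded_compositions_uniq.
    rewrite cat_uniq /single; apply/and3P; split.
    - by case: (n <= q).
    - apply/hasPn => -[|j s]; first by rewrite mem_single andbF.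
      rewrite mem_longer mem_single => /andP[_ s_in]; apply/negP => /andP[_].
      by case/eqP => _ s0; rewrite s0 (negPf (nil_notin _)) in s_in.
    - apply: allpairs_uniq_dep => [|j _|]; first exact: iota_uniq.
        exact: bounded_compositions_uniq.
      by move=> [i r] [j s] _ _ /= [-> ->].
  move=> [|j s]; rewrite mem_cat mem_single.
    by rewrite (negPf (nil_notin _)) (negPf nil_longer) andbF.
  rewrite mem_longer mem_bounded_compositions_cons // andb_orr eqseq_cons.
  by congr (_ || _); case: eqP => [->|_] //=; rewrite ?andbF // mem_iota n_gt0.
rewrite -size_bounded_compositions (perm_size perm) size_cat size_nseq.
congr (_ + _); rewrite size_allpairs_dep sumnE big_map /index_iota subn1.
by apply: eq_bigr => j _; rewrite size_bounded_compositions.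
Qed.

Lemma t0 q : t q 0 = 0.
Proof.
rewrite -size_bounded_compositions; apply/eqP; rewrite size_eq0.
apply/eqP; case E: (bounded_compositions q 0) => [//|s r].
have := mem_head s r; rewrite -E mem_bounded_compositions /is_composition.
by case: s {E} => [|[|a] s]; rewrite //= addSn andbF.
Qed.

Lemma sum_expn2 n : (\sum_(i < n) 2 ^ i).+1 = 2 ^ n.
Proof.
elim: n => [|n IHn]; first by rewrite big_ord0.
by rewrite big_ord_recr /= -addSn IHn expnS mul2n addnn.
Qed.

Lemma t_small q n : 0 < n -> n <= q -> t q n = 2 ^ (n - 1).
Proof.
elim/ltn_ind: n => -[//|n] IHn _ n_le_q.
rewrite t_first_part // n_le_q subn1 /= add1n.
(* The number being composed is now [n.+1]. Terms with [j >= n.+1] truncate to [t q 0] and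
   vanish. *)
rewrite (@big_cat_nat _ _ _ n.+1) ?(leqW n_le_q) //=.
have -> : \sum_(n.+1 <= j < q.+1) t q (n.+1 - j) = 0.
  rewrite big_nat big1 // => j /andP[le_nj _].
  have /eqP -> : n.+1 - j == 0 by rewrite subn_eq0.
  exact: t0.
(* What remains is the geometric sum 1 + (1 + 2 + ... + 2^(n-1)) = 2^n; the powers are reversed
   because [t q (n - j)] decreases in exponent as [j] grows. *)
rewrite addn0 -sum_expn2 big_add1 /= -(big_mkord xpredT) [in RHS]big_nat_rev /=.
congr _.+1; apply: eq_big_nat => j /andP[_ lt_jn]; rewrite subSS add0n.
rewrite IHn ?subn_gt0 ?ltnS ?leq_subr //; first by rewrite -subnDA addn1.
exact: leq_trans (leq_subr _ _) (ltnW n_le_q).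
Qed.

Theorem theorem6 (q : nat) (hq : 0 < q) (n : nat) (hn : 0 < n) :
  t q n = if n <= q then 2 ^ (n - 1)
          else \sum_(1 <= j < q.+1) t q (n - j).
Proof.
case: ifP => [n_le_q | q_lt_n]; first exact: t_small.
by rewrite t_first_part // q_lt_n.
Qed.
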